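(* There is an absolute constant $C>0$ such that the following holds. For every $\varepsilon\in(0,1)$, every $n\geqslant 2$, all item sizes $s_1,\ldots,s_n\in\mathbb{R}_+$ and every demand $D\in\mathbb{R}_+$, there exists an extended formulation of size at most $(1/\varepsilon)^{C}n^{C\log n}$ defining an LP relaxation of the min-knapsack problem with item sizes $s_1,\dots,s_n$ and demand $D$ whose integrality gap is at most $2+\varepsilon$.
   Context: Min-knapsack: given positive item sizes $s_1,\dots,s_n$, a positive demand $D$ and nonnegative costs $c_1,\dots,c_n$, solve $\min\{\sum_{i=1}^n c_ix_i \mid \sum_{i=1}^n s_ix_i\geqslant D,\ x\in\{0,1\}^n\}$. Let $P$ be the min-knapsack polytope, i.e. the convex hull of the feasible points $\{x\in\{0,1\}^n\mid \sum_i s_ix_i\geqslant D\}$ (assumed nonempty). An extended formulation is a system $E^{\leqslant}x+F^{\leqslant}y\leqslant g^{\leqslant}$, $E^{=}x+F^{=}y=g^{=}$ in variables $(x,y)\in\mathbb{R}^{n+k}$; its size is the number of inequalities; it defines the polyhedron $R=\{x\in\mathbb{R}^n\mid \exists y: E^{\leqslant}x+F^{\leqslant}y\leqslant g^{\leqslant},\ E^{=}x+F^{=}y=g^{=}\}$. It defines an LP relaxation of min-knapsack if $P\subseteq R$; the relaxation depends only on the sizes and the demand, not on the costs. Its integrality gap is the supremum, over all nonnegative cost vectors $c$, of the ratio of $\min\{c^\intercal x\mid x\in P\}$ to $\min\{c^\intercal x\mid x\in R\}$ (i.e. the claim means that for every $c\in\mathbb{R}^n_{\geqslant0}$ the integer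 optimum is at most $(2+\varepsilon)\min\{c^\intercal x\mid x\in R\}$). *)

(* Defs.v *)
From HB Require Import structures.
From mathcomp Require Import all_boot all_order all_algebra.
From mathcomp Require Import reals exp Rstruct.
Set Implicit Arguments. Unset Strict Implicit. Unset Printing Implicit Defensive.
Import Order.TTheory GRing.Theory Num.Theory.
Local Open Scope ring_scope.

Notation RR := Rdefinitions.R.

Definition dotv (n : nat) (c x : 'cV[RR]_n) : RR := \sum_(i < n) c i 0 * x i 0.

Definition knap_feasible (n : nat) (s : 'cV[RR]_n) (D : RR) (x : 'cV[RR]_n) : Prop :=
  (forall i, x i 0 = 0 \/ x i 0 = 1) /\ D <= dotv s x.

Definition knap_polytope (n : nat) (s : 'cV[RR]_n) (D : RR) (x : 'cV[RR]_n) : Prop :=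
  exists (N : nat) (lam : 'I_N -> RR) (pts : 'I_N -> 'cV[RR]_n),
    [/\ forall j, 0 <= lam j,
        \sum_(j < N) lam j = 1,
        forall j, knap_feasible s D (pts j) &
        x = \sum_(j < N) lam j *: pts j].

(* An extended formulation with k extra variables, m inequalities
   E1 x + F1 y <= g1 and p equalities E2 x + F2 y = g2. Its size is m. *)
Record ext_form (n : nat) := ExtForm {
  ef_k : nat; ef_m : nat; ef_p : nat;
  ef_E1 : 'M[RR]_(ef_m, n); ef_F1 : 'M[RR]_(ef_m, ef_k); ef_g1 : 'cV[RR]_ef_m;
  ef_E2 : 'M[RR]_(ef_p, n); ef_F2 : 'M[RR]_(ef_p, ef_k); ef_g2 : 'cV[RR]_ef_p }.

Definition ef_size (n : nat) (Q : ext_form n) : nat := ef_m Q.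

Definition ef_region (n : nat) (Q : ext_form n) (x : 'cV[RR]_n) : Prop :=
  exists y : 'cV[RR]_(ef_k Q),
    (forall i, (ef_E1 Q *m x + ef_F1 Q *m y) i 0 <= ef_g1 Q i 0) /\
    ef_E2 Q *m x + ef_F2 Q *m y = ef_g2 Q.

Definition is_relaxation (n : nat) (s : 'cV[RR]_n) (D : RR) (Q : ext_form n) : Prop :=
  forall x, knap_polytope s D x -> ef_region Q x.

(* integrality gap at most alpha: for every nonnegative cost vector c,
   min{c^T z | z in P} <= alpha * c^T x for every x in R
   (i.e. <= alpha * inf{c^T x | x in R}); the minimum over the compact
   nonempty P is attained, so we state it by a witness z in P. *)
Definition gap_at_most (n : nat) (s : 'cV[RR]_n) (D : RR) (Q : ext_form n)
    (alpha : RR) : Prop :=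
  forall c : 'cV[RR]_n, (forall i, 0 <= c i 0) ->
  forall x, ef_region Q x ->
  exists2 z, knap_polytope s D z & dotv c z <= alpha * dotv c x.

(* Main.v *)
Require Import Defs.
From HB Require Import structures.
From mathcomp Require Import all_boot all_order all_algebra.
From mathcomp Require Import reals exp Rstruct.
From mathcomp Require Import zify ring lra.
Set Implicit Arguments. Unset Strict Implicit. Unset Printing Implicit Defensive.
Import Order.TTheory GRing.Theory Num.Theory.
Local Open Scope ring_scope.

(* For a set A of items with residual demand r = D - s(A) > 0, the knapsack cover
   inequality reads sum_{i notin A} min(s_i, r) x_i >= r, and a point satisfying
   it up to a factor 1 - eps/3 for A = {i | (2 + eps) x_i >= 1} can be rounded at
   the cost of a factor 2 + eps, greedily. To obtain all these inequalities, let
   s_k be the largest size below r and S = {i | s_i <= s_k}. For mu = j (eps/3) s_k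
   just below r + s(A /\ S), a feasible set B either weighs at least mu on S, a
   single linear inequality, or at least D - mu > s(A \ S) off S, in which case
   it has an item outside A and S, and that item has size at least r. Hence x is
   put in the convex hull of two pieces, for each of the polynomially many (k, j).

   The second piece comes from a monotone formula for a weighted threshold
   function f: replacing "and" by intersection, "or" by convex hull of the union
   and literals by faces of the cube gives a polytope containing f^{-1}(1) which
   satisfies sum_{i notin A} x_i >= 1 whenever f(A) = 0. By Frank and Tardos the
   weights can be taken to be integers with polynomially many bits. Comparing their
   sum with the threshold bit by bit is the run of a monotone automaton with O(n)
   states on a word of polynomial length, and guessing the middle state
   recursively yields a formula of size n^O(log n). *)

(** * Cones described by few inequalities *)

(* [S t x] is a polyhedral cone in [(t, x)]; the polyhedron it stands for is its
   slice [S 1]. The number [N] bounds the inequalities only, as in [ef_size]. *)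
Definition lifted (R : realFieldType) (n N : nat) (S : R -> 'cV[R]_n -> Prop) : Prop :=
  exists k m p (G : 'M[R]_(m, k)) (H : 'M[R]_(p, k)) (P : 'M[R]_(n, k)) (l : 'rV[R]_k),
  (m <= N)%N /\
  forall t x, S t x <->
    exists z : 'cV[R]_k, [/\ forall i, 0 <= (G *m z) i 0, H *m z = 0,
                             x = P *m z & t%:M = l *m z].

Lemma lifted_ext (R : realFieldType) (n N : nat) (S S' : R -> 'cV[R]_n -> Prop) :
  (forall t x, S t x <-> S' t x) -> lifted N S -> lifted N S'.
Proof.
move=> SS' [k [m [p [G [H [P [l [mN defS]]]]]]]].
exists k, m, p, G, H, P, l; split=> // t x.
by split=> [/SS'/defS | /defS/SS'].
Qed.

Lemma lifted_leq (R : realFieldType) (n N N' : nat) (S : R -> 'cV[R]_n -> Prop) :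
  (N <= N')%N -> lifted N S -> lifted N' S.
Proof.
move=> NN' [k [m [p [G [H [P [l [mN defS]]]]]]]].
by exists k, m, p, G, H, P, l; split=> //; apply: leq_trans NN'.
Qed.

Lemma col_mx_ge0 (R : realFieldType) m1 m2 (u : 'cV[R]_m1) (v : 'cV[R]_m2) :
  (forall i, 0 <= col_mx u v i 0) <->
  (forall i, 0 <= u i 0) /\ (forall i, 0 <= v i 0).
Proof.
split=> [ge0 | [u0 v0] i]; last by rewrite mxE; case: split.
by split=> i; [have := ge0 (lshift m2 i); rewrite col_mxEu
              | have := ge0 (rshift m1 i); rewrite col_mxEd].
Qed.

Lemma mul_block_diag_col (R : realFieldType) m1 m2 k1 k2 (A : 'M[R]_(m1, k1))
    (B : 'M[R]_(m2, k2)) (u : 'cV[R]_k1) (v : 'cV[R]_k2) :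
  block_mx A 0 0 B *m col_mx u v = col_mx (A *m u) (B *m v).
Proof. by rewrite mul_block_col !mul0mx addr0 add0r. Qed.

(** Stack the two lifting vectors and identify their projections [(t, x)] by equalities; these are
    not counted, so the sizes just add. *)
Lemma lifted_and (R : realFieldType) (n N1 N2 : nat) (S1 S2 : R -> 'cV[R]_n -> Prop) :
  lifted N1 S1 -> lifted N2 S2 ->
  lifted (N1 + N2) (fun t x => S1 t x /\ S2 t x).
Proof.
move=> [k1 [m1 [p1 [G1 [H1 [P1 [l1 [mN1 defS1]]]]]]]].
move=> [k2 [m2 [p2 [G2 [H2 [P2 [l2 [mN2 defS2]]]]]]]].
exists (k1 + k2)%N, (m1 + m2)%N, (p1 + p2 + (n + 1))%N.
exists (block_mx G1 0 0 G2).
exists (col_mx (block_mx H1 0 0 H2) (col_mx (row_mx P1 (- P2)) (row_mx l1 (- l2)))).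
exists (row_mx P1 0), (row_mx l1 0); split; first exact: leq_add.
move=> t x; split.
  case=> /defS1[z1 [G1z H1z Px1 lt1]] /defS2[z2 [G2z H2z Px2 lt2]].
  exists (col_mx z1 z2); split.
  - by rewrite mul_block_diag_col; apply/col_mx_ge0.
  - rewrite mul_col_mx mul_block_diag_col H1z H2z mul_col_mx !mul_row_col !mulNmx.
    by rewrite -Px1 -Px2 -lt1 -lt2 !subrr !col_mx0.
  - by rewrite mul_row_col mul0mx addr0.
  - by rewrite mul_row_col mul0mx addr0.
case=> z; rewrite -[z]vsubmxK; move: (usubmx z) (dsubmx z) => z1 z2 [].
rewrite mul_block_diag_col => /col_mx_ge0[G1z G2z].
rewrite mul_col_mx mul_block_diag_col mul_col_mx !mul_row_col !mulNmx !mul0mx !addr0.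
rewrite -[X in _ = X]col_mx0 => /eq_col_mx[].
rewrite -[X in _ = X]col_mx0 => /eq_col_mx[H1z H2z].
rewrite -[X in _ = X]col_mx0 => /eq_col_mx[/eqP + /eqP].
rewrite !subr_eq0 => /eqP P12 /eqP l12 Px lt.
split; [apply/defS1; exists z1 | apply/defS2; exists z2]; split=> //.
  by rewrite -P12.
by rewrite -l12.
Qed.

Lemma lifted_add (R : realFieldType) (n N1 N2 : nat) (S1 S2 : R -> 'cV[R]_n -> Prop) :
  lifted N1 S1 -> lifted N2 S2 ->
  lifted (N1 + N2) (fun t x => exists t1 x1 t2 x2,
    [/\ S1 t1 x1, S2 t2 x2, t = t1 + t2 & x = x1 + x2]).
Proof.
move=> [k1 [m1 [p1 [G1 [H1 [P1 [l1 [mN1 defS1]]]]]]]].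
move=> [k2 [m2 [p2 [G2 [H2 [P2 [l2 [mN2 defS2]]]]]]]].
exists (k1 + k2)%N, (m1 + m2)%N, (p1 + p2)%N.
exists (block_mx G1 0 0 G2), (block_mx H1 0 0 H2), (row_mx P1 P2), (row_mx l1 l2).
split; first exact: leq_add.
move=> t x; split.
  case=> t1 [x1 [t2 [x2 []]]].
  move=> /defS1[z1 [G1z H1z Px1 lt1]] /defS2[z2 [G2z H2z Px2 lt2]] -> ->.
  exists (col_mx z1 z2); split.
  - by rewrite mul_block_diag_col; apply/col_mx_ge0.
  - by rewrite mul_block_diag_col H1z H2z col_mx0.
  - by rewrite mul_row_col Px1 Px2.
  - by rewrite mul_row_col raddfD /= lt1 lt2.
case=> z; rewrite -[z]vsubmxK; move: (usubmx z) (dsubmx z) => z1 z2 [].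
rewrite !mul_block_diag_col => /col_mx_ge0[G1z G2z].
rewrite -[X in _ = X]col_mx0 => /eq_col_mx[H1z H2z].
rewrite !mul_row_col => Px lt.
exists ((l1 *m z1) 0 0), (P1 *m z1), ((l2 *m z2) 0 0), (P2 *m z2); split=> //.
- by apply/defS1; exists z1; split=> //; rewrite -mx11_scalar.
- by apply/defS2; exists z2; split=> //; rewrite -mx11_scalar.
- by move/matrixP/(_ 0 0): lt; rewrite !mxE eqxx mulr1n.
Qed.

(** In a Minkowski sum, this lets a point of one cone be completed by the origin of the other. *)
Lemma lifted_origin (R : realFieldType) (n N : nat) (S : R -> 'cV[R]_n -> Prop) :
  lifted N S -> S 0 0.
Proof.
move=> [k [m [p [G [H [P [l [_ defS]]]]]]]]; apply/defS.
by exists 0; split=> [i|||]; rewrite !mulmx0 ?mxE ?raddf0.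
Qed.

Lemma lifted_zero (R : realFieldType) (n : nat) :
  lifted 0 (fun (t : R) (x : 'cV[R]_n) => t = 0 /\ x = 0).
Proof.
exists 0, 0, 0, 0, 0, 0, 0; split=> // t x; split=> [[-> ->]|[z [_ _ -> lt]]].
  exists 0; split; rewrite ?mulmx0 //; last by rewrite raddf0.
  by move=> i; rewrite mxE.
rewrite mul0mx; split=> //; move/matrixP/(_ 0 0): lt.
by rewrite mul0mx !mxE eqxx mulr1n.
Qed.

Lemma lifted_halfspace (R : realFieldType) (n : nat) (b : R) (a : 'I_n -> R) :
  lifted 1 (fun t (x : 'cV[R]_n) => 0 <= b * t + \sum_i a i * x i 0).
Proof.
exists (1 + n)%N, 1%N, 0, (row_mx b%:M (\row_i a i)), 0, (row_mx 0 1%:M), (row_mx 1%:M 0).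
have Gz (t : R) (x : 'cV[R]_n) : (row_mx b%:M (\row_i a i) *m col_mx t%:M x) 0 0
    = b * t + \sum_i a i * x i 0.
  rewrite mul_row_col -scalar_mxM !mxE eqxx mulr1n.
  by congr (_ + _); apply: eq_bigr => i _; rewrite mxE.
split=> // t x; split.
  move=> ge0; exists (col_mx t%:M x); split.
  - by move=> i; rewrite ord1 Gz.
  - by rewrite mul0mx.
  - by rewrite mul_row_col mul0mx mul1mx add0r.
  - by rewrite mul_row_col mul0mx mul1mx addr0.
case=> z; rewrite -[z]vsubmxK; move: (usubmx z) (dsubmx z) => z1 z2 [].
rewrite !mul_row_col !mul0mx !mul1mx add0r addr0 => /(_ 0) + _ -> tz.
by rewrite -tz -mul_row_col Gz.
Qed.

Lemma lifted_full (R : realFieldType) (n : nat) :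
  lifted 0 (fun (t : R) (x : 'cV[R]_n) => True).
Proof.
exists (1 + n)%N, 0, 0, 0, 0, (row_mx 0 1%:M), (row_mx 1%:M 0).
split=> // t x; split=> // _; exists (col_mx t%:M x); split=> [[]|||] //.
- by rewrite mul0mx.
- by rewrite mul_row_col mul0mx mul1mx add0r.
- by rewrite mul_row_col mul0mx mul1mx addr0.
Qed.

Lemma lifted_all (R : realFieldType) (n N : nat) (I : eqType) (r : seq I)
    (S : I -> R -> 'cV[R]_n -> Prop) :
  (forall i, i \in r -> lifted N (S i)) ->
  lifted (size r * N) (fun t x => forall i, i \in r -> S i t x).
Proof.
elim: r => [|i r IHr] liftS.
  by apply: lifted_ext (lifted_full _ _).
rewrite /= mulSn.
have liftSr : forall j, j \in r -> lifted N (S j).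
  by move=> j jr; apply: liftS; rewrite inE jr orbT.
apply: lifted_ext (lifted_and (liftS i (mem_head _ _)) (IHr liftSr)) => t x.
split=> [[Si Sr] j | allS].
  by rewrite inE => /predU1P[->|/Sr].
by split=> [|j jr]; apply: allS; rewrite inE ?eqxx ?jr ?orbT.
Qed.

Definition in_box (R : realFieldType) (n : nat) (t : R) (x : 'cV[R]_n) : Prop :=
  0 <= t /\ forall i, 0 <= x i 0 <= t.

Lemma lifted_box (R : realFieldType) (n : nat) :
  lifted (n.*2).+1 (@in_box R n).
Proof.
have lift_i (i : 'I_n) : lifted 2 (fun t (x : 'cV[R]_n) => 0 <= x i 0 <= t).
  apply: (lifted_ext _ (lifted_and
     (lifted_halfspace 0 (fun j => (j == i)%:R))
     (lifted_halfspace 1 (fun j => - (j == i)%:R)))) => t x.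
  rewrite mul0r add0r mul1r (bigD1 i) //= eqxx mul1r.
  rewrite big1 ?addr0; last by move=> j /negPf ->; rewrite mul0r.
  rewrite (bigD1 i) //= eqxx mulN1r.
  rewrite big1 ?addr0 ?subr_ge0; last by move=> j /negPf ->; rewrite oppr0 mul0r.
  by split=> [[-> ->]//|/andP].
have := lifted_and (lifted_halfspace 1 (fun=> 0))
          (lifted_all (r := enum 'I_n) (fun i _ => lift_i i)).
rewrite add1n size_enum_ord muln2; apply: lifted_ext => t x.
rewrite mul1r big1 ?addr0 => [|i _]; last by rewrite mul0r.
by split=> -[t0 xt]; split=> // i; apply: xt; rewrite mem_enum.
Qed.

(** Containing the feasible 0/1 points thus suffices for containing the knapsack polytope. *)
Lemma lifted_convex (R : realFieldType) (n N M : nat) (S : R -> 'cV[R]_n -> Prop)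
    (lam : 'I_M -> R) (pts : 'I_M -> 'cV[R]_n) :
  lifted N S -> (forall j, 0 <= lam j) -> \sum_j lam j = 1 -> (forall j, S 1 (pts j)) ->
  S 1 (\sum_j lam j *: pts j).
Proof.
move=> [k [m [p [G [H [P [l [_ defS]]]]]]]] lam0 lam1 S_pts.
have /fin_all_exists[z Sz] j : exists z : 'cV[R]_k, [/\ forall i, 0 <= (G *m z) i 0,
    H *m z = 0, pts j = P *m z & 1%:M = l *m z] by apply/defS.
apply/defS; exists (\sum_j lam j *: z j); split.
- move=> i; rewrite mulmx_sumr summxE; apply: sumr_ge0 => j _.
  by rewrite -scalemxAr mxE mulr_ge0 //; case: (Sz j).
- by rewrite mulmx_sumr big1 // => j _; rewrite -scalemxAr; case: (Sz j) => _ ->; rewrite scaler0.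
- by rewrite mulmx_sumr; apply: eq_bigr => j _; rewrite -scalemxAr; case: (Sz j) => _ _ ->.
- rewrite mulmx_sumr -lam1 -scalemx1 scaler_suml.
  by apply: eq_bigr => j _; rewrite -scalemxAr; case: (Sz j) => _ _ _ <-.
Qed.

Lemma ext_form_of_lifted (n N : nat) (S : RR -> 'cV[RR]_n -> Prop) : lifted N S ->
  exists Q : ext_form n, (ef_size Q <= N)%N /\ forall x, ef_region Q x <-> S 1 x.
Proof.
move=> [k [m [p [G [H [P [l [mN defS]]]]]]]].
(* The slice conditions [x = P *m y] and [l *m y = 1] become equalities, so only the [m] rows of [G]
   count. *)
pose Q := @ExtForm n k m (p + (n + 1)) 0 (- G) 0
  (col_mx 0 (col_mx 1%:M 0)) (col_mx H (col_mx (- P) l)) (col_mx 0 (col_mx 0 1%:M)).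
exists Q; split=> // x.
have eqE (y : 'cV_k) : ef_E2 Q *m x + ef_F2 Q *m y =
    col_mx (H *m y) (col_mx (x - P *m y) (l *m y)).
  by rewrite !mul_col_mx !add_col_mx !mul0mx mul1mx mulNmx !add0r.
have ineqE (y : 'cV_k) i : (ef_E1 Q *m x + ef_F1 Q *m y) i 0 = - (G *m y) i 0.
  by rewrite mul0mx add0r mulNmx mxE.
have g0 i : ef_g1 Q i 0 = 0 by rewrite mxE.
split=> [[y [Gy]]|/defS[z [Gz Hz Pz lz]]].
  rewrite eqE => /eq_col_mx[Hy /eq_col_mx[/eqP + ly]]; rewrite subr_eq0 => /eqP xP.
  by apply/defS; exists y; split=> // i; have := Gy i; rewrite ineqE g0 oppr_le0.
exists z; split=> [i|]; first by rewrite ineqE g0 oppr_le0.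
by rewrite eqE Hz -Pz subrr -lz.
Qed.

(** * Monotone formulas and covering inequalities *)

Definition chi (R : realFieldType) (n : nat) (A : {set 'I_n}) : 'cV[R]_n :=
  \col_i (i \in A)%:R.

(* A homogeneous relaxation of the convex hull of the sets satisfying [f], which
   must meet the complement of every [A] violating [f]. *)
Definition covering (R : realFieldType) (n : nat) (f : {set 'I_n} -> bool) (N : nat) : Prop :=
  exists S : R -> 'cV[R]_n -> Prop,
  [/\ lifted N S,
      forall B, f B -> S 1 (chi R B),
      forall t x, S t x -> in_box t x &
      forall t x A, S t x -> ~~ f A -> t <= \sum_(i | i \notin A) x i 0].

Lemma in_box_chi (R : realFieldType) (n : nat) (A : {set 'I_n}) : in_box 1 (chi R A).
Proof. by split=> // i; rewrite mxE; case: (i \in A); rewrite ?lexx ?ler01. Qed.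

Lemma in_box_add (R : realFieldType) (n : nat) (t u : R) (x y : 'cV[R]_n) :
  in_box t x -> in_box u y -> in_box (t + u) (x + y).
Proof.
move=> [t0 xt] [u0 yu]; split=> [|i]; first exact: addr_ge0.
by rewrite mxE; have := xt i; have := yu i; lra.
Qed.

Section Covering.
Variables (R : realFieldType) (n : nat).
Implicit Types (f g : {set 'I_n} -> bool) (N : nat).

Lemma covering_ext f g N : f =1 g -> covering R f N -> covering R g N.
Proof.
move=> fg [S [liftS Sf Sbox Sg]]; exists S; split=> // [B | t x A].
  by rewrite -fg; apply: Sf.
by rewrite -fg; apply: Sg.
Qed.

Lemma covering_leq f N N' : (N <= N')%N -> covering R f N -> covering R f N'.
Proof. by move=> NN' [S [liftS *]]; exists S; split=> //; apply: lifted_leq liftS. Qed.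

Lemma covering_and f g N N' : covering R f N -> covering R g N' ->
  covering R (fun A => f A && g A) (N + N').
Proof.
move=> [S [liftS Sf Sbox Sg]] [S' [liftS' Sf' Sbox' Sg']].
eexists; split; first exact: lifted_and liftS liftS'.
- by move=> B /andP[fB gB]; split; [apply: Sf | apply: Sf'].
- by move=> t x [/Sbox].
- by move=> t x A [Sx S'x]; rewrite negb_and => /orP[/(Sg _ _ _ Sx)|/(Sg' _ _ _ S'x)].
Qed.

(* The Minkowski sum of the cones is the cone over the convex hull of the union. *)
Lemma covering_or f g N N' : covering R f N -> covering R g N' ->
  covering R (fun A => f A || g A) (N + N').
Proof.
move=> [S [liftS Sf Sbox Sg]] [S' [liftS' Sf' Sbox' Sg']].
eexists; split; first exact: lifted_add liftS liftS'.
- move=> B /orP[/Sf SB | /Sf' SB].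
    by exists 1, (chi R B), 0, 0; rewrite !addr0; split=> //; apply: lifted_origin liftS'.
  by exists 0, 0, 1, (chi R B); rewrite !add0r; split=> //; apply: lifted_origin liftS.
- by move=> t x [t1 [x1 [t2 [x2 [/Sbox b1 /Sbox' b2 -> ->]]]]]; apply: in_box_add.
- move=> t x A [t1 [x1 [t2 [x2 [S1 S2 -> ->]]]]]; rewrite negb_or => /andP[nf ng].
  under eq_bigr do rewrite mxE.
  by rewrite big_split lerD ?(Sg _ _ _ S1) ?(Sg' _ _ _ S2).
Qed.

Lemma covering_false : covering R (fun _ : {set 'I_n} => false) 0.
Proof.
eexists; split; first exact: lifted_zero.
- by [].
- by move=> t x [-> ->]; split=> // i; rewrite mxE lexx.
- by move=> t x A [-> ->] _; apply: sumr_ge0 => i _; rewrite mxE.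
Qed.

Lemma covering_true : covering R (fun _ : {set 'I_n} => true) (n.*2).+1.
Proof.
eexists; split; first exact: lifted_box.
- by move=> B _; apply: in_box_chi.
- by [].
- by [].
Qed.

(** The cone is the face [x i = t] of the homogenized cube; for [i] outside [A], the term [x i]
    alone reaches [t]. *)
Lemma covering_mem (i : 'I_n) : covering R (fun A : {set 'I_n} => i \in A) (n.*2).+2.
Proof.
eexists; split.
- rewrite -addn1; apply: lifted_and (lifted_box R n) _.
  exact: (lifted_halfspace (- 1) (fun j => (j == i)%:R)).
- move=> B iB; split; first exact: in_box_chi.
  rewrite (bigD1 i) //= eqxx mxE iB big1 ?addr0; first by rewrite !mulr1 addNr.
  by move=> j /negPf ->; rewrite mul0r.
- by move=> t x [].
- move=> t x A [[t0 xt] ge0] iA.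
  move: ge0; rewrite (bigD1 i) //= eqxx big1 ?addr0; last by move=> j /negPf ->; rewrite mul0r.
  rewrite mulN1r mul1r addrC subr_ge0 => /le_trans; apply.
  rewrite (bigD1 i) //= lerDl sumr_ge0 // => j _.
  by case/andP: (xt j).
Qed.

Lemma covering_has (I : eqType) (r : seq I) (f : I -> {set 'I_n} -> bool) N :
  (forall j, j \in r -> covering R (f j) N) ->
  covering R (fun A => has (fun j => f j A) r) (size r * N).
Proof.
elim: r => [|j r IHr] covf; first by apply: covering_ext covering_false.
rewrite /= mulSn; apply: covering_or; first by apply: covf; rewrite mem_head.
by apply: IHr => k kr; apply: covf; rewrite inE kr orbT.
Qed.

End Covering.

(** * Weighted threshold functions with integer weights *)

(* The value [v = sum_(i in A) a i - t] is computed by a Horner scheme on the binary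
   digits. At a digit boundary [v >= 1] and [v <= - n] are never left again, so
   the state [p], which stands for [v + n.*2], may be clipped to [0, n.*2 + 1];
   truncated subtraction does the lower clipping. *)
Inductive step (n : nat) := Double of bool | Add of 'I_n.

Section Automaton.
Variables (R : realFieldType) (n : nat).
Implicit Types (l : seq (step n)) (A : {set 'I_n}).

(** With [p = v + n.*2], [Double b] performs [v := 2 v - b], whence the new state
    [p.*2 - n.*2 - b]. *)
Definition step_eval A (p : nat) (s : step n) : nat :=
  match s with
  | Double b => minn (p.*2 - n.*2 - b) (n.*2).+1
  | Add i => minn (p + (i \in A)) (n.*2).+1
  end.

Definition run A l p := foldl (step_eval A) p l.

Lemma step_eval_le A p s : (step_eval A p s <= (n.*2).+1)%N.
Proof. by case: s => *; apply: geq_minr. Qed.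

Lemma run_le A l p : (p <= (n.*2).+1)%N -> (run A l p <= (n.*2).+1)%N.
Proof. by elim: l p => //= s l IHl p _; apply/IHl/step_eval_le. Qed.

Lemma run_mono A l p q : (p <= q)%N -> (run A l p <= run A l q)%N.
Proof.
elim: l p q => //= s l IHl p q pq; apply: IHl.
by case: s => [b|i] /=; lia.
Qed.

Lemma covering_const (b : bool) :
  covering R (fun _ : {set 'I_n} => b) (n.*2).+2.
Proof.
case: b; first by apply: covering_leq (covering_true _ _).
by apply: covering_leq (covering_false _ _).
Qed.

(** The test depends on [A] only for [Add i] with [q = p.+1] in range, where it is the literal
    [i \in A]; otherwise it is constant. *)
Lemma covering_step (s : step n) p q :
  covering R (fun A => q <= step_eval A p s)%N (n.*2).+2.
Proof.
case: s => [b|i] /=; first exact: covering_const.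
have [q_gt|q_le] := ltnP (n.*2).+1 q.
  apply: covering_ext (covering_const false) => A; lia.
have [qp|pq] := leqP q p.
  apply: covering_ext (covering_const true) => A; lia.
have [qp|q_p1] := ltnP p.+1 q.
  by apply: covering_ext (covering_const false) => A; case: (i \in A); lia.
by apply: covering_ext (covering_mem R i) => A; case: (i \in A); lia.
Qed.

(** Each halving of the word branches over the [(n.*2).+2] middle states with two subformulas each;
    a leaf is a constant or a literal. *)
Definition run_bound d := ((2 * (n.*2).+2) ^ d * (n.*2).+2)%N.

(** Savitch-style halving. The middle state is guessed only as a lower bound [r], so no negation
    appears; [run_mono] makes this equivalent to knowing it exactly. *)
Lemma covering_run d l p q : (size l <= 2 ^ d)%N -> (p <= (n.*2).+1)%N ->
  covering R (fun A => q <= run A l p)%N (run_bound d).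
Proof.
elim: d l p q => [|d IHd] l p q; rewrite /run_bound.
  rewrite mul1n; case: l => [|s [|//]] _ _; first exact: (covering_const (q <= p)%N).
  exact: (covering_step s p q).
move=> size_l p_le; rewrite -[l](cat_take_drop (2 ^ d)).
set l1 := take _ l; set l2 := drop _ l.
have size1 : (size l1 <= 2 ^ d)%N by rewrite size_take; case: ltnP.
have size2 : (size l2 <= 2 ^ d)%N by rewrite size_drop; move: size_l; rewrite expnS; lia.
rewrite expnS -!mulnA (mulnCA 2) -[X in (X * _)%N](size_iota 0).
have cov r : r \in iota 0 (n.*2).+2 -> covering R (fun A => (r <= run A l1 p) && (q <= run A l2 r))%N
     (2 * ((2 * (n.*2).+2) ^ d * (n.*2).+2)).
  rewrite mem_iota add0n ltnS => /andP[_ r_le].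
  by rewrite mul2n -addnn; apply: covering_and; apply: IHd.
apply: covering_ext (covering_has cov) => A; rewrite /run foldl_cat -/(run A l1 p) -/(run A l2 _).
apply/hasP/idP => [[r _ /andP[rp /leq_trans]]|qr]; first by apply; apply: run_mono.
exists (run A l1 p); last by rewrite leqnn.
by rewrite mem_iota ltnS run_le.
Qed.

Definition adders (a : 'I_n -> nat) := [seq Add i | i <- enum 'I_n & odd (a i)].

(** Most significant digits come first: the halved data are processed before the doubling and the
    additions for the lowest digit. *)
Fixpoint program J (a : 'I_n -> nat) (t : nat) : seq (step n) :=
  if J is J'.+1 then
    program J' (fun i => (a i)./2) t./2 ++ Double n (odd t) :: adders a
  else [::].

Lemma size_program J a t : (size (program J a t) <= J * n.+1)%N.
Proof.
elim: J a t => //= J IHJ a t; rewrite size_cat /= size_map mulSn addnC leq_add //.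
by rewrite ltnS size_filter (leq_trans (count_size _ _)) // size_enum_ord.
Qed.

(* The last case is the rejecting one: at a digit boundary [k = n], after the
   doubling [k = 0], and [k] grows by one with each addition. *)
Definition tracks (k p : nat) (v : int) : Prop :=
  p%:Z = v + (n.*2)%:Z \/ ((n.*2 < p)%N /\ 0 < v) \/ ((p <= k)%N /\ v + (n.*2)%:Z <= k%:Z).

Lemma tracks_leq k k' p v : (k <= k')%N -> tracks k p v -> tracks k' p v.
Proof. by rewrite /tracks; lia. Qed.

Lemma tracks_adders A (r : seq 'I_n) k p v :
  (k + size r <= n.*2)%N -> tracks k p v ->
  tracks (k + size r) (run A [seq Add i | i <- r] p) (v + \sum_(i <- r) (i \in A)%:Z).
Proof.
elim: r k p v => [|i r IHr] k p v.
  by rewrite /= big_nil addn0 addr0.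
rewrite /= big_cons addrA -addSnnS => kr trk; apply: IHr => //.
rewrite /tracks /=; case: (i \in A); move: trk; rewrite /tracks; lia.
Qed.

Lemma tracks_program J a t A : (forall i, a i < 2 ^ J)%N -> (t < 2 ^ J)%N ->
  tracks n (run A (program J a t) n.*2) ((\sum_(i in A) a i)%N%:Z - t%:Z).
Proof.
elim: J a t => [|J IHJ] a t a_lt t_lt.
  left; rewrite big1 /=; last by move=> i _; have := a_lt i; rewrite expn0; lia.
  by move: t_lt; rewrite expn0; lia.
set p0 := run A (program J (fun i => (a i)./2) t./2) n.*2.
have -> : run A (program J.+1 a t) n.*2 =
    run A (adders a) (step_eval A p0 (Double n (odd t))) by rewrite /run foldl_cat.
pose v' : int := (\sum_(i in A) (a i)./2)%N%:Z - (t./2)%:Z.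
have trk : tracks n p0 v'.
  by apply: IHJ => [i|]; [have := a_lt i | move: t_lt]; rewrite expnS; lia.
have -> : (\sum_(i in A) a i)%N%:Z - t%:Z =
    (v' * 2 - (odd t)%:Z) + \sum_(i <- enum 'I_n | odd (a i)) (i \in A)%:Z.
  have -> : (\sum_(i in A) a i = (\sum_(i in A) (a i)./2) * 2 + \sum_(i in A) odd (a i))%N.
    rewrite big_distrl -big_split; apply: eq_bigr => i _ /=; lia.
  have -> : \sum_(i <- enum 'I_n | odd (a i)) (i \in A)%:Z = (\sum_(i in A) odd (a i))%N%:Z.
    rewrite [RHS](_ : _ = \sum_(i in A) (odd (a i))%:Z); last by rewrite -natz natr_sum; apply: eq_bigr => i _; rewrite natz.
    rewrite big_enum_cond [LHS]big_mkcond [RHS]big_mkcond /=.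
    by apply: eq_bigr => i _; case: (odd _); case: (i \in A).
  rewrite /v'; lia.
rewrite -big_filter /adders.
set r := [seq i <- _ | _].
have size_r : (size r <= n)%N.
  by rewrite size_filter (leq_trans (count_size _ _)) // size_enum_ord.
apply: (tracks_leq size_r); rewrite -[size r]add0n; apply: tracks_adders; first by lia.
(* If [v >= 1] then [2 v - b >= 1]; if [v <= - n] then [2 v - b <= - n.*2], and [p <= n] is
   truncated to state 0. So both verdicts survive the doubling, with [k] reset to 0. *)
by move: trk; rewrite /tracks /=; lia.
Qed.

Lemma covering_nat_threshold J d a t : (forall i, a i < 2 ^ J)%N -> (t < 2 ^ J)%N ->
  (J * n.+1 <= 2 ^ d)%N -> (0 < n)%N ->
  covering R (fun A => t <= \sum_(i in A) a i)%N (run_bound d).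
Proof.
move=> a_lt t_lt Jd n0.
have size_d := leq_trans (size_program J a t) Jd.
apply: covering_ext (@covering_run d (program J a t) n.*2 n.*2 size_d _) => [A|]; last by [].
(* The final state is at least [n.*2] exactly when [v >= 0]: a rejecting run ends with
   [p <= n < n.*2] and [v <= - n < 0]. *)
by have := tracks_program A a_lt t_lt; rewrite /tracks; lia.
Qed.

End Automaton.

(** * Integer weights of polynomial bit length *)

(** Pigeonhole on the fractional parts of the multiples [k * u]: two of [N.+1 ^ m + 1] share one of
    [N.+1 ^ m] boxes, and their difference gives [q]. Integral coordinates incur no error. *)
Lemma dirichlet (R : archiRealFieldType) (m N : nat) (u : 'I_m -> R) :
  exists (q : nat) (p : 'I_m -> int),
  [/\ (0 < q <= N.+1 ^ m)%N,
      forall i, `|q%:R * u i - (p i)%:~R| < N.+1%:R^-1 &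
      forall i, u i \is a Num.int -> (p i)%:~R = q%:R * u i].
Proof.
pose fr (k : nat) i : R := k%:R * u i - (Num.floor (k%:R * u i))%:~R.
have fr_ge0 k i : 0 <= fr k i by rewrite subr_ge0 floor_le.
have fr_lt1 k i : fr k i < 1.
  by rewrite ltrBlDl; have := floorD1_gt (k%:R * u i); rewrite intrD.
pose fl k i := Num.floor (N.+1%:R * fr k i).
have fl_ge0 k i : 0 <= fl k i by rewrite floor_ge0 mulr_ge0.
have fl_lt k i : (`|fl k i| < N.+1)%N.
  suff: fl k i < N.+1%:Z by have := fl_ge0 k i; lia.
  by rewrite floor_lt_int gtr_pMr ?fr_lt1.
pose box (k : 'I_(N.+1 ^ m).+1) : {ffun 'I_m -> 'I_N.+1} :=
  [ffun i => Ordinal (fl_lt k i)].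
have /injectivePn[k1 [k2 k12 eq_box]] : ~~ injectiveb box.
  apply/negP => /injectiveP/leq_card.
  by rewrite card_ffun !card_ord ltnn.
wlog lt_k : k1 k2 k12 eq_box / (k2 < k1)%N.
  move=> W; case: (ltngtP k1 k2) => [/W|/W|/val_inj k1k2]; last by rewrite k1k2 eqxx in k12.
    by apply; rewrite // eq_sym.
  exact.
exists (k1 - k2)%N, (fun i => Num.floor (k1%:R * u i) - Num.floor (k2%:R * u i)).
split=> [|i|i ui].
- by have := ltn_ord k1; lia.
- have eq_fl : fl k1 i = fl k2 i.
    move/ffunP/(_ i): eq_box; rewrite !ffunE => /(congr1 val) /= eq_abs.
    by rewrite -(gez0_abs (fl_ge0 k1 i)) eq_abs gez0_abs.
  have -> : (k1 - k2)%N%:R * u i - (Num.floor (k1%:R * u i) - Num.floor (k2%:R * u i))%:~R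
      = fr k1 i - fr k2 i by rewrite natrB ?(ltnW lt_k) // intrB /fr; ring.
  have N0 : 0 < N.+1%:R :> R by [].
  rewrite -(ltr_pM2l N0) divff ?gt_eqF // -{1}(gtr0_norm N0) -normrM mulrBr.
  have := floor_itv (N.+1%:R * fr k1 i); rewrite -/(fl _ _) eq_fl.
  have := floor_itv (N.+1%:R * fr k2 i); rewrite -/(fl _ _) intrD.
  rewrite ltr_norml; lra.
- rewrite intrB natrB ?(ltnW lt_k) // mulrBl.
  by rewrite !floorK ?rpredM ?rpred_nat.
Qed.

(** Growth per reduction round: with [Q = m.+1 ^ m] and [B >= 1],
    [(m * B + 1) * Q + B <= m.+2 * Q * B]. *)
Definition weight_bound m := (m.+2 * m.+1 ^ m)%N.

(* Frank and Tardos: a rounding [p] of a multiple of [u] decides the sign of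
   [u . v] unless [p . v = 0], and then the residual, which has one more zero
   coordinate than [u], decides it. *)
Lemma integer_weights (R : archiRealFieldType) (m k : nat) (u : 'I_m -> R) :
  (#|[set i | u i != 0%R]| <= k)%N ->
  exists w : 'I_m -> int,
  (forall i, `|w i| <= (weight_bound m ^ k)%N) /\
  forall v : 'I_m -> int, (forall i, `|v i| <= 1)%R ->
    (0 <= \sum_i u i * (v i)%:~R) = (0 <= \sum_i w i * v i).
Proof.
have zero_case k' (u' : 'I_m -> R) : (forall i, u' i = 0) ->
    exists w : 'I_m -> int, (forall i, `|w i| <= (weight_bound m ^ k')%N) /\
    forall v : 'I_m -> int, (forall i, `|v i| <= 1)%R ->
    (0 <= \sum_i u' i * (v i)%:~R) = (0 <= \sum_i w i * v i).
  move=> u0; exists (fun=> 0); split=> [i|v _]; first by rewrite normr0.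
  rewrite !big1 ?lexx // => i _; first by rewrite mul0r.
  by rewrite u0 mul0r.
elim: k u => [|k IHk] u supp_u.
  apply: zero_case => i; move: supp_u; rewrite leqn0 cards_eq0 => /eqP/setP/(_ i).
  by rewrite !inE => /negbFE/eqP.
have [i1 ui1|u0] := pickP [pred i | u i != 0]; last first.
  by apply: zero_case => i; apply/eqP; have := u0 i; rewrite /= => /negbFE.
have [i0 _ max_i0] := @arg_maxP _ R _ i1 xpredT (fun i => `|u i|) isT.
set a := `|u i0|.
have u_max i : `|u i| <= a by exact: max_i0.
have a0 : 0 < a by apply: lt_le_trans (u_max i1); rewrite normr_gt0.
(* Scaling by the largest modulus makes coordinate [i0] equal to 1 or -1, so its residual vanishes.
   Precision [1 / m.+1] keeps the residual form below 1, the least nonzero modulus of [p . v]. *)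
have [q [p [q_bd p_near p_int]]] := dirichlet m (fun i => u i / a).
set r := fun i => q%:R * (u i / a) - (p i)%:~R.
have r0 i : u i = 0 -> r i = 0.
  by move=> ui; rewrite /r p_int ui ?mul0r ?subrr // rpred0.
have ri0 : r i0 = 0.
  rewrite /r p_int ?subrr // [u i0]numEsg -mulrA divff ?gt_eqF // mulr1.
  by rewrite sgrEz rpred_int_num.
have supp_r : (#|[set i | r i != 0%R]| <= k)%N.
  rewrite -ltnS; apply: leq_trans supp_u; apply: proper_card; apply/properP; split.
    by apply/subsetP => i; rewrite !inE; apply: contra_neq; apply: r0.
  by exists i0; rewrite !inE ?ri0 ?eqxx // -normr_gt0.
have [w [w_bd w_sgn]] := IHk r supp_r.
set B := (weight_bound m ^ k)%N in w_bd.
(* [M] exceeds [|w . v|], so [w . v] decides the sign only when [p . v = 0]. *)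
pose M := (m * B).+1.
have a_max i : `|u i / a| <= 1.
  by rewrite normrM normfV (gtr0_norm a0) ler_pdivrMr // mul1r.
have inv_lt1 : m.+1%:R^-1 <= 1 :> R by rewrite invf_le1 // ler1n.
have p_bd i : `|p i| <= (m.+1 ^ m)%N.
  suff: `|(p i)%:~R : R| < (q + 1)%N%:Z%:~R.
    by rewrite -intr_norm ltr_int; case/andP: q_bd; lia.
  have -> : (p i)%:~R = q%:R * (u i / a) - r i by rewrite /r; ring.
  apply: le_lt_trans (ler_normB _ _) _; rewrite normrM normr_nat -[ltRHS]/((q + 1)%:R) natrD.
  rewrite ler_ltD //; last by apply: lt_le_trans (p_near i) inv_lt1.
  by rewrite ler_piMr.
exists (fun i => M%:Z * p i + w i); split=> [i|v v_bd].
  have B1 : (0 < B)%N by rewrite /B /weight_bound expn_gt0 muln_gt0 expn_gt0.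
  have Q1 : (0 < m.+1 ^ m)%N by rewrite expn_gt0.
  have BQ : (B <= B * m.+1 ^ m)%N by rewrite leq_pmulr.
  have BQ' : (m.+1 ^ m <= B * m.+1 ^ m)%N by rewrite leq_pmull.
  have -> : (weight_bound m ^ k.+1 = m * B * m.+1 ^ m + 2 * (B * m.+1 ^ m))%N.
    by rewrite expnS -/B /weight_bound; ring.
  apply: le_trans (ler_normD _ _) _; rewrite normrM.
  have : `|M%:Z| * `|p i| <= M%:Z * (m.+1 ^ m)%N by rewrite ler_wpM2l.
  have : M%:Z * (m.+1 ^ m)%N = (m * B * m.+1 ^ m + m.+1 ^ m)%N by rewrite /M; ring.
  by have := w_bd i; lia.
set pv := \sum_i p i * v i.
set wv := \sum_i w i * v i.
set rv := \sum_i r i * (v i)%:~R.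
have -> : \sum_i (M%:Z * p i + w i) * v i = M%:Z * pv + wv.
  by rewrite /pv mulr_sumr -big_split; apply: eq_bigr => i _ /=; ring.
have -> : (0 <= \sum_i u i * (v i)%:~R) = (0 <= pv%:~R + rv).
  have -> : pv%:~R + rv = q%:R / a * \sum_i u i * (v i)%:~R.
    rewrite /pv /rv mulr_sumr rmorph_sum -big_split /=; apply: eq_bigr => i _.
    by rewrite /r intrM; field; apply: lt0r_neq0.
  by rewrite pmulr_rge0 // divr_gt0 // ltr0n; case/andP: q_bd.
have wv_bd : `|wv| <= (m * B)%N.
  apply: le_trans (ler_norm_sum _ _ _) _.
  have -> : (m * B)%N%:Z = \sum_(i < m) B%:Z by rewrite sumr_const card_ord PoszM -mulr_natl natz.
  by apply: ler_sum => i _; rewrite normrM -[leRHS]mulr1 ler_pM.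
have rv_bd : `|rv| < 1.
  apply: le_lt_trans (ler_norm_sum _ _ _) _.
  apply: (@le_lt_trans _ _ (\sum_(i < m) m.+1%:R^-1)).
    apply: ler_sum => i _; rewrite normrM -[leRHS]mulr1 ler_pM //; first exact/ltW/p_near.
    by rewrite -intr_norm -[leRHS]/(1%:~R) ler_int.
  by rewrite sumr_const card_ord -[X in X < _]mulr_natl ltr_pdivrMr // mul1r ltr_nat.
have [pv_lt0|pv_gt0|pv0] := ltrgtP pv 0; last by rewrite pv0 mulr0 !add0r w_sgn.
  have : pv%:~R <= -1 :> R by rewrite -[leRHS]/((-1)%:~R) ler_int; lia.
  have -> : (0 <= M%:Z * pv + wv) = false.
    have : M%:Z * pv <= M%:Z * -1 by rewrite ler_wpM2l // -ltzD1 addNr.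
    by move: wv_bd; rewrite /M; lia.
  by move: rv_bd; rewrite ltr_norml => rv_bd ?; apply/negbTE; lra.
have : 1 <= pv%:~R :> R by rewrite -[leLHS]/(1%:~R) ler_int; lia.
have -> : 0 <= M%:Z * pv + wv.
  have : M%:Z * 1 <= M%:Z * pv by rewrite ler_wpM2l.
  by move: wv_bd; rewrite /M; lia.
by move: rv_bd; rewrite ltr_norml => rv_bd ?; lra.
Qed.

(** * Weighted threshold functions with real weights *)

(* With [n <= 2 ^ l], the formula depth [4 l + 6] and [2 (2 n + 2) <= 2 ^ (l + 3)]
   give [run_bound n (4 l + 6) <= 2 ^ ((l + 3) (4 l + 6) + l + 2)]. *)
Definition threshold_size l := (2 ^ (43 * l ^ 2))%N.

Lemma leq_expn_add k l n m : (n <= 2 ^ k -> m <= 2 ^ l -> n * m <= 2 ^ (k + l))%N.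
Proof. by move=> nk ml; rewrite expnD leq_mul. Qed.

Lemma leq_expn_succ l : (l.+2 <= 2 ^ l.+1)%N.
Proof. by rewrite ltn_expl. Qed.

Lemma box_size_le n l : (0 < n <= 2 ^ l)%N -> ((n.*2).+2 <= 2 ^ l.+2)%N.
Proof. by rewrite !expnS; lia. Qed.

Lemma box_le_threshold n l : (0 < l)%N -> (0 < n <= 2 ^ l)%N -> ((n.*2).+2 <= threshold_size l)%N.
Proof.
move=> l0 /box_size_le /leq_trans; apply; rewrite leq_exp2l //.
have : (l <= l ^ 2)%N by rewrite leq_pmull.
lia.
Qed.

Lemma weight_bound_lt n l : (0 < l)%N -> (0 < n <= 2 ^ l)%N ->
  (weight_bound n.+1 ^ n.+1 < 2 ^ ((l.+2 * n.+2) * n.+1).+1)%N.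
Proof.
move=> l0 nl; rewrite [ltnRHS]expnS mul2n -addnn -addn1 leq_add ?expn_gt0 //.
rewrite [in leqRHS]expnM leq_exp2r // expnM expnS /weight_bound.
have le1 : (n.+2 <= 2 ^ l.+2)%N by move: nl; rewrite !expnS; lia.
have le2 : (n.+3 <= 2 ^ l.+2)%N by move: nl; rewrite !expnS; lia.
by rewrite leq_mul // leq_exp2r.
Qed.

Lemma run_bound_le n l : (0 < l)%N -> (0 < n <= 2 ^ l)%N ->
  (run_bound n (4 * l + 6) <= threshold_size l)%N.
Proof.
move=> l0 nl; have le1 := box_size_le nl.
have le2 : (2 * (n.*2).+2 <= 2 ^ l.+3)%N by rewrite expnS leq_mul2l.
apply: (@leq_trans (2 ^ (l.+3 * (4 * l + 6) + l.+2))).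
  by apply: leq_expn_add => //; rewrite expnM leq_exp2r //; lia.
rewrite leq_exp2l //; apply: (@leq_trans ((4 * l) * (10 * l) + 3 * l ^ 2)).
  rewrite leq_add //; first by rewrite leq_mul //; lia.
  have : (l <= l ^ 2)%N by rewrite leq_pmull.
  lia.
rewrite (_ : 4 * l * (10 * l) = 40 * l ^ 2)%N; last by ring.
by rewrite -mulnDl leqnn.
Qed.

Lemma covering_threshold (R : archiRealFieldType) (n l : nat) (u : 'I_n -> R) (th : R) :
  (0 < l)%N -> (0 < n <= 2 ^ l)%N -> (forall i, 0 <= u i) ->
  covering R (fun A : {set 'I_n} => th <= \sum_(i in A) u i) (threshold_size l).
Proof.
move=> l0 nl u0.
have [th_le0|th_gt0] := lerP th 0.
  apply: covering_leq (box_le_threshold l0 nl) _.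
  apply: covering_ext (covering_const _ _ true) => A.
  by apply/esym; apply: le_trans th_le0 _; apply: sumr_ge0.
(* The threshold becomes coordinate 0, to be rounded jointly with the weights; the comparison for
   [A] is tested by -1 there and the indicator of [A] elsewhere. *)
pose U i := oapp u th (unlift ord0 i).
have [|w [w_bd w_sgn]] := @integer_weights R n.+1 n.+1 U.
  by rewrite (leq_trans (max_card _)) ?card_ord.
(* Unit vectors are admissible tests, so the signs of the coordinates carry over. *)
have w_ge0 i : 0 <= w i.
  have := w_sgn (fun j => (j == i)%:Z).
  rewrite (bigD1 i) //= [X in _ = (0 <= X)](bigD1 i) //= eqxx !mulr1.
  rewrite !big1 ?addr0; try by move=> j /negPf ->; rewrite mulr0.
  move=> <- => [|j]; last by case: eqP.
  by rewrite /U; case: unliftP => [j|] _ /=; [apply: u0 | apply: ltW].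
pose J := ((l.+2 * n.+2) * n.+1).+1.
have w_lt i : (`|w i| < 2 ^ J)%N.
  by have := weight_bound_lt l0 nl; have := w_bd i; have := w_ge0 i; rewrite -/J; lia.
apply: covering_leq (run_bound_le l0 nl) _.
apply: covering_ext (@covering_nat_threshold R n J (4 * l + 6)
  (fun i => `|w (lift ord0 i)|%N) `|w ord0|%N _ _ _ _) => //; last by case/andP: nl.
- move=> A; pose v i := oapp (fun j => (j \in A)%:Z) (-1) (unlift ord0 i).
  have := w_sgn v; rewrite !big_ord_recl /U /v !unlift_none /=.
  under eq_bigr do rewrite liftK /=.
  under [X in _ = (0 <= _ + X)]eq_bigr do rewrite liftK /=.
  have -> : \sum_(i < n) u i * (i \in A)%:Z%:~R = \sum_(i in A) u i.
    rewrite [RHS]big_mkcond; apply: eq_bigr => i _.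
    by case: (i \in A); rewrite ?mulr1 ?mulr0.
  have -> : \sum_(i < n) w (lift ord0 i) * (i \in A)%:Z = (\sum_(i in A) `|w (lift ord0 i)|)%N.
    rewrite -natz natr_sum [RHS]big_mkcond; apply: eq_bigr => i _.
    by case: (i \in A); rewrite ?mulr1 ?mulr0 // natz gez0_abs.
  rewrite mulrN1 addrC subr_ge0 => -> => [|i]; last first.
    by case: unliftP => //= j _; case: (j \in A).
  by rewrite -[w ord0 in RHS]gez0_abs // mulrN1 addrC subr_ge0 lez_nat.
- have le1 : (l.+2 <= 2 ^ l.+1)%N := leq_expn_succ l.
  have le2 : (n.+2 <= 2 ^ l.+2)%N by move: nl; rewrite !expnS; lia.
  have le3 : (n.+1 <= 2 ^ l.+1)%N by move: nl; rewrite !expnS; lia.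
  have le4 := leq_expn_add (leq_expn_add le1 le2) le3.
  have le5 : (J <= 2 ^ (l.+1 + l.+2 + l.+1).+1)%N.
    by rewrite /J expnS; move: le4; have := expn_gt0 2 (l.+1 + l.+2 + l.+1); lia.
  have := leq_expn_add le5 le3; rewrite -/J => /leq_trans; apply.
  by rewrite leq_exp2l //; lia.
Qed.

(** * Approximate knapsack cover inequalities *)

Definition relaxable (R : realFieldType) (n N : nat) (f : {set 'I_n} -> bool)
    (C : 'cV[R]_n -> Prop) : Prop :=
  exists S : R -> 'cV[R]_n -> Prop,
  [/\ lifted N S, forall B, f B -> S 1 (chi R B) & forall x, S 1 x -> C x].

Section Relaxable.
Variables (R : realFieldType) (n : nat) (f : {set 'I_n} -> bool).
Implicit Types (N : nat) (C : 'cV[R]_n -> Prop).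

Lemma relaxable_and N N' C C' : relaxable N f C -> relaxable N' f C' ->
  relaxable (N + N') f (fun x => C x /\ C' x).
Proof.
move=> [S [liftS Sf SC]] [S' [liftS' Sf' SC']].
eexists; split; first exact: lifted_and liftS liftS'.
  by move=> B fB; split; [apply: Sf | apply: Sf'].
by move=> x [/SC Cx /SC'].
Qed.

Lemma relaxable_all (I : eqType) (r : seq I) N (C : I -> 'cV[R]_n -> Prop) :
  (forall i, i \in r -> relaxable N f (C i)) ->
  relaxable (size r * N) f (fun x => forall i, i \in r -> C i x).
Proof.
elim: r => [|i r IHr] relC.
  by eexists; split; first exact: lifted_full.
have := relaxable_and (relC i (mem_head i r))
  (IHr (fun j jr => relC j (mem_behead (s := i :: r) jr))).
move=> [S [liftS Sf SC]]; exists S; split=> // x /SC[Ci Cr] j.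
by rewrite inE => /predU1P[->|/Cr].
Qed.

End Relaxable.

Lemma big_notin_setU (R : realFieldType) (n : nat) (A S : {set 'I_n}) (F : 'I_n -> R) :
  \sum_(i | i \notin A :|: S) F i = \sum_(i | (i \notin A) && (i \notin S)) F i.
Proof. by apply: eq_bigl => i; rewrite inE negb_or. Qed.

(* A feasible point puts weight [D - mu] on the items outside [S] or weight [mu]
   on those of [S]. *)
Lemma relaxable_split (R : archiRealFieldType) (n l : nat) (s : 'I_n -> R) (D mu : R)
    (S : {set 'I_n}) :
  (0 < l)%N -> (0 < n <= 2 ^ l)%N -> (forall i, 0 < s i) ->
  relaxable (threshold_size l + (n.*2).+2) (fun B => D <= \sum_(i in B) s i)
   (fun x => exists t1 x1 t2 x2,
     [/\ 1 = t1 + t2 :> R, x = x1 + x2, in_box t1 x1 & in_box t2 x2] /\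
     (forall A : {set 'I_n}, \sum_(i in A | i \notin S) s i < D - mu ->
        t1 <= \sum_(i | (i \notin A) && (i \notin S)) x1 i 0) /\
     mu * t2 <= \sum_(i in S) s i * x2 i 0).
Proof.
move=> l0 nl s0.
pose u i := if i \in S then 0 else s i.
have u0 i : 0 <= u i by rewrite /u; case: ifP => // _; apply: ltW.
have [T [liftT Tf Tbox TA]] := covering_threshold (D - mu) l0 nl u0.
have sum_u A : \sum_(i in A) u i = \sum_(i in A | i \notin S) s i.
  by rewrite [RHS]big_mkcondr; apply: eq_bigr => i _; rewrite /u; case: (i \in S).
have lift2 := lifted_and (lifted_box R n)
  (lifted_halfspace (- mu) (fun i => if i \in S then s i else 0)).
have sum_S (x : 'cV[R]_n) :
    \sum_i (if i \in S then s i else 0) * x i 0 = \sum_(i in S) s i * x i 0.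
  by rewrite [RHS]big_mkcond; apply: eq_bigr => i _; case: ifP; rewrite ?mul0r.
have T0 := lifted_origin liftT.
eexists; split.
- rewrite -(addn1 (n.*2).+1); apply: lifted_add liftT lift2.
- move=> B DB; have [uB|uB] := lerP (D - mu) (\sum_(i in B) u i).
    exists 1, (chi R B), 0, 0; split; rewrite ?addr0 //; first exact: Tf.
    split; first by split=> // i; rewrite mxE lexx.
    by rewrite mulr0 add0r sumr_ge0 // => i _; rewrite mxE mulr0.
  exists 0, 0, 1, (chi R B); split; rewrite ?add0r //.
  split; first exact: in_box_chi.
  rewrite sum_S mulr1 addrC subr_ge0.
  have -> : \sum_(i in S) s i * chi R B i 0 = \sum_(i in B | i \in S) s i.
    rewrite big_mkcond [RHS]big_mkcond; apply: eq_bigr => i _; rewrite mxE.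
    by case: (i \in S); case: (i \in B); rewrite ?mulr1 ?mulr0.
  by move: DB uB; rewrite sum_u (bigID (mem S)) /=; lra.
- move=> x [t1 [x1 [t2 [x2 [T1 [box2 T2] tE xE]]]]].
  exists t1, x1, t2, x2; split; first by split=> //; apply: Tbox T1.
  split; last by move: T2; rewrite sum_S; lra.
  move=> A; rewrite -big_notin_setU => sA; apply: TA T1 _.
  rewrite -ltNge sum_u; apply: le_lt_trans sA; rewrite le_eqVlt; apply/orP; left.
  by apply/eqP/eq_bigl => i; rewrite inE; case: (i \in S); rewrite ?andbF ?orbF.
Qed.

(* The knapsack cover inequalities up to the relative error [d]. *)
Definition knapsack_cover (R : realFieldType) (n : nat) (s : 'I_n -> R) (D d : R)
    (x : 'cV[R]_n) : Prop :=
  forall A : {set 'I_n}, let r := D - \sum_(i in A) s i in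
  0 < r -> (1 - d) * r <= \sum_(i | i \notin A) Num.min (s i) r * x i 0.

Lemma knapsack_cover_relaxable (R : archiRealFieldType) (n l J : nat) (s : 'I_n -> R) (D d : R) :
  (0 < l)%N -> (0 < n <= 2 ^ l)%N -> (forall i, 0 < s i) -> 0 <= d -> n%:R < J%:R * d ->
  relaxable ((n.*2).+1 + (threshold_size l + n * J.+1 * (threshold_size l + (n.*2).+2)))
    (fun B => D <= \sum_(i in B) s i) (fun x => in_box 1 x /\ knapsack_cover s D d x).
Proof.
move=> l0 nl s0 d0 Jd.
pose f (B : {set 'I_n}) := D <= \sum_(i in B) s i.
have relbox : relaxable (n.*2).+1 f (@in_box R n 1).
  eexists; split; first exact: lifted_box; last by [].
  by move=> B _; apply: in_box_chi.
(* This handles residual demands [rho] below which there is no size: there every coefficient of the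
   cover inequality is [rho]. *)
have reltop : relaxable (threshold_size l) f (fun x : 'cV[R]_n => forall A : {set 'I_n},
    \sum_(i in A) s i < D -> 1 <= \sum_(i | i \notin A) x i 0).
  have [T [liftT Tf _ TA]] := covering_threshold D l0 nl (fun i => ltW (s0 i)).
  by exists T; split=> // x Tx A sA; apply: TA Tx _; rewrite -ltNge.
pose below k := [set i | s i <= s k].
pose r := [seq (k, j) | k <- enum 'I_n, j <- iota 0 J.+1].
have relall := relaxable_all (r := r) (fun (kj : 'I_n * nat) _ =>
   relaxable_split D (kj.2%:R * d * s kj.1) (below kj.1) l0 nl s0).
have size_r : size r = (n * J.+1)%N by rewrite size_allpairs size_enum_ord size_iota.
have [S [liftS Sf SC]] := relaxable_and relbox (relaxable_and reltop relall).
rewrite -size_r; exists S; split=> // x /SC[box_x [top_x all_x]]; split=> // A rho rho0.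
have x0 i : 0 <= x i 0 by case/andP: (box_x.2 i).
have [k0 small_k0 | nosmall] := pickP [pred i | s i < rho]; last first.
  have rho_le i : rho <= s i by rewrite leNgt; apply/negP => lt; have := nosmall i; rewrite /= lt.
  apply: (@le_trans _ _ (rho * 1)); first by rewrite mulr1 ler_piMl ?(ltW rho0) // gerBl.
  apply: (@le_trans _ _ (rho * \sum_(i | i \notin A) x i 0)).
    by rewrite ler_wpM2l ?(ltW rho0) // top_x // -subr_gt0.
  by rewrite mulr_sumr ler_sum // => i _; rewrite min_r.
have [k small_k max_k] := @arg_maxP _ R _ k0 [pred i | s i < rho] s small_k0.
rewrite /= in small_k.
have le_k i : s i < rho -> s i <= s k by move=> /max_k.
(* With [mu = j * d * s k], the condition [mu < g] says that [A] weighs less than [D - mu] off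
   [below k], as the first piece requires. *)
pose g := rho + \sum_(i in A | i \in below k) s i.
have sum_ge0 : 0 <= \sum_(i in A | i \in below k) s i.
  by apply: sumr_ge0 => i _; apply: ltW.
have g0 : 0 < g by rewrite /g; lra.
pose P j := (j <= J)%N && (j%:R * d * s k < g).
have P0 : exists j, P j by exists 0; rewrite /P !mul0r.
have PJ j : P j -> (j <= J)%N by case/andP.
case: (ex_maxnP P0 PJ) => j /andP[jJ jg] max_j.
have kjr : (k, j) \in r.
  by apply/allpairsP; exists (k, j); split; rewrite ?mem_enum ?mem_iota.
have [t1 [x1 [t2 [x2 [[tE xE [t1_0 x1t] [t2_0 x2t]] [cov1 lin2]]]]]] := all_x _ kjr.
rewrite /= in cov1 lin2.
have min0 i : 0 <= Num.min (s i) rho by rewrite le_min !ltW.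
rewrite (_ : (1 - d) * rho = (1 - d) * rho * t1 + (1 - d) * rho * t2); last by rewrite -mulrDr -tE mulr1.
rewrite (_ : \sum_(i | i \notin A) _ = \sum_(i | i \notin A) Num.min (s i) rho * x1 i 0
    + \sum_(i | i \notin A) Num.min (s i) rho * x2 i 0); last first.
  by rewrite -big_split; apply: eq_bigr => i _; rewrite xE mxE mulrDr.
apply: lerD.
  apply: (@le_trans _ _ (rho * t1)).
    by rewrite ler_wpM2r // ler_piMl ?(ltW rho0) // gerBl.
  apply: (@le_trans _ _ (rho * \sum_(i | (i \notin A) && (i \notin below k)) x1 i 0)).
    rewrite ler_wpM2l ?(ltW rho0) //; apply: cov1.
    have := erefl (\sum_(i in A) s i); rewrite {1}(bigID (mem (below k))) /=.
    by move: jg; rewrite /g /rho; lra.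
  rewrite mulr_sumr [leRHS](bigID (mem (below k))) /= -[leLHS]add0r lerD //.
    by apply: sumr_ge0 => i _; rewrite mulr_ge0 //; case/andP: (x1t i).
  apply: ler_sum => i /andP[_]; rewrite inE -ltNge => ki; rewrite min_r //.
  by rewrite leNgt; apply/negP => /le_k; rewrite leNgt ki.
(* Of the weight [mu * t2] on [below k], items of [A] account for at most their full size times
   [t2]. *)
have lin_le : (j%:R * d * s k - \sum_(i in A | i \in below k) s i) * t2 <=
    \sum_(i | i \notin A) Num.min (s i) rho * x2 i 0.
  apply: (@le_trans _ _ (\sum_(i | (i \notin A) && (i \in below k)) s i * x2 i 0)).
    rewrite mulrBl; move: lin2; rewrite (bigID (mem A)) /=.
    have -> : \sum_(i in below k | i \notin A) s i * x2 i 0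
        = \sum_(i | (i \notin A) && (i \in below k)) s i * x2 i 0.
      by apply: eq_bigl => i; rewrite andbC.
    have : \sum_(i in below k | i \in A) s i * x2 i 0 <= (\sum_(i in A | i \in below k) s i) * t2.
      rewrite mulr_suml [leLHS](eq_bigl (fun i => (i \in A) && (i \in below k))).
        by apply: ler_sum => i _; apply: ler_wpM2l; [apply: ltW | case/andP: (x2t i)].
      by move=> i; rewrite andbC.
    by lra.
  rewrite [leRHS](bigID (mem (below k))) /= -[leLHS]addr0 lerD //; last first.
    by apply: sumr_ge0 => i _; rewrite mulr_ge0 //; case/andP: (x2t i).
  apply: ler_sum => i /andP[_]; rewrite inE => ik; rewrite min_l //.
  by apply: ltW; apply: le_lt_trans ik small_k.
have [jJ' | Jj] := ltnP j J.
  (* Maximality of [j] gives [mu >= g - d * s k], and [s k < rho] bounds the loss by [d * rho]. *)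
  apply: le_trans lin_le; rewrite ler_wpM2r //.
  have : g <= j.+1%:R * d * s k.
    rewrite leNgt; apply/negP => lt; have := max_j j.+1; rewrite /P jJ' lt => /(_ isT).
    by rewrite ltnn.
  rewrite /g -natr1 2!mulrDl mul1r.
  have : d * s k <= d * rho by rewrite ler_wpM2l // ltW.
  by lra.
(* At [j = J] the linear piece asks more weight than [below k] has, so it is the
   origin. *)
have eq_j : j = J by apply/eqP; rewrite eqn_leq jJ.
have le_J : J%:R * d * s k * t2 <= n%:R * s k * t2.
  rewrite -eq_j; apply: le_trans lin2 _.
  apply: (@le_trans _ _ (\sum_(i < n) s k * t2)); last first.
    by rewrite sumr_const card_ord -mulrA mulr_natl.
  rewrite big_mkcond; apply: ler_sum => i _; case: ifP => [|_].
    rewrite inE => ik; case/andP: (x2t i) => ? ?.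
    by rewrite ler_pM // ltW.
  by rewrite mulr_ge0 // ltW.
have -> : t2 = 0.
  apply/eqP; rewrite eq_le t2_0 andbT.
  by move: le_J; rewrite -subr_le0 -!mulrBl pmulr_rle0 // mulr_gt0 // subr_gt0.
by rewrite mulr0; apply: sumr_ge0 => i _; rewrite mulr_ge0 //; case/andP: (x2t i).
Qed.

(** * Rounding *)

(* A set closed under passing to smaller ratios [c / s] is a cheapest fractional
   solution for its own weight, and a minimal one of weight at least [r] has
   weight at most [2 * r]. *)
Lemma greedy_cover (R : realFieldType) (n : nat) (U : {set 'I_n}) (s c z : 'I_n -> R) (r : R) :
  0 < r -> (forall i, 0 < s i <= r) -> (forall i, 0 <= c i) ->
  (forall i, i \in U -> 0 <= z i <= 1) -> 2 * r <= \sum_(i in U) s i * z i ->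
  exists T : {set 'I_n}, [/\ T \subset U, r <= \sum_(i in T) s i &
    \sum_(i in T) c i <= \sum_(i in U) c i * z i].
Proof.
move=> r0 s0r c0 z01 sz.
have s0 i : 0 < s i by case/andP: (s0r i).
pose good (T : {set 'I_n}) := [&& T \subset U, r <= \sum_(i in T) s i &
  [forall i in T, forall j in U :\: T, c i / s i <= c j / s j]].
have goodU : good U.
  rewrite /good subxx /=; apply/andP; split.
    apply: (@le_trans _ _ (2 * r)); first by rewrite ler_pMl // ler1n.
    apply: le_trans sz _; apply: ler_sum => i iU.
    by apply: ler_piMr; [apply: ltW | case/andP: (z01 i iU)].
  by apply/forall_inP => i _; apply/forall_inP => j; rewrite setDv inE.
case: (arg_minnP (fun T : {set 'I_n} => #|T|) goodU) => T /and3P[TU rT ratioT] min_T.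
have [i0 i0T] : exists i, i \in T.
  apply/set0Pn; apply: contraTneq rT => ->; by rewrite big_set0 -ltNge.
have [m mT max_m] := @arg_maxP _ R _ i0 (mem T) (fun i => c i / s i) i0T.
set rho := c m / s m.
have le_rho i : i \in T -> c i <= rho * s i.
  by move=> iT; rewrite -ler_pdivrMr //; apply: max_m.
have ge_rho i : i \in U -> i \notin T -> rho * s i <= c i.
  move=> iU iT; rewrite -ler_pdivlMr //.
  by move/forall_inP/(_ m mT)/forall_inP: ratioT; apply; rewrite inE iT.
(* Dropping the worst item [m] keeps the ratio condition, so by minimality the rest weighs less than
   [r], and [m] itself at most [r]. *)
have sT : \sum_(i in T) s i <= \sum_(i in U) s i * z i.
  apply: le_trans sz; rewrite (bigD1 m) //= (_ : 2 * r = r + r); last by ring.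
  rewrite lerD //; first by case/andP: (s0r m).
  rewrite leNgt; apply/negP => r_lt.
  have /min_T : good (T :\ m).
    rewrite /good (subset_trans (subD1set T m) TU) /=; apply/andP; split.
      rewrite (eq_bigl (fun i => (i \in T) && (i != m))) => [|i]; first exact: ltW.
      by rewrite !inE andbC.
    apply/forall_inP => i; rewrite !inE => /andP[im iT].
    apply/forall_inP => j; rewrite !inE negb_and negbK => /andP[/orP[/eqP->|jT] jU].
      exact: max_m.
    by move/forall_inP/(_ i iT)/forall_inP: ratioT; apply; rewrite inE jT.
  by rewrite [#|T|](cardsD1 m) (mT : m \in T) ltnn.
have rho0 : 0 <= rho by rewrite divr_ge0 // ltW.
exists T; split=> //; rewrite -subr_ge0.
(* Termwise exchange at price [rho]: on [T], [z i - 1 <= 0] and [c i <= rho * s i]; off [T], both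
   signs are reversed. *)
apply: (@le_trans _ _ (rho * (\sum_(i in U) s i * z i - \sum_(i in T) s i))).
  by rewrite mulr_ge0 // subr_ge0.
have sum_T (F : 'I_n -> R) : \sum_(i in T) F i = \sum_(i in U) (i \in T)%:R * F i.
  rewrite [LHS]big_mkcond [RHS]big_mkcond; apply: eq_bigr => i _.
  case: (boolP (i \in T)) => [/(subsetP TU) ->|_]; first by rewrite mul1r.
  by rewrite mul0r if_same.
rewrite !sum_T -!sumrB mulr_sumr; apply: ler_sum => i iU.
have /andP[z0 z1] := z01 i iU.
case: (boolP (i \in T)) => iT.
  by have := le_rho i iT; rewrite !mul1r; nra.
by have := ge_rho i iU iT; rewrite !mul0r !subr0; nra.
Qed.

Lemma knapsack_cover_round (R : realFieldType) (n : nat) (s c : 'I_n -> R) (D eps : R)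
    (x : 'cV[R]_n) :
  0 < eps -> eps < 1 -> (forall i, 0 < s i) -> (forall i, 0 <= c i) ->
  in_box 1 x -> knapsack_cover s D (eps / 3) x ->
  exists T : {set 'I_n}, D <= \sum_(i in T) s i /\
    \sum_(i in T) c i <= (2 + eps) * \sum_i c i * x i 0.
Proof.
move=> eps0 eps1 s0 c0 [_ x01] kc.
pose A := [set i | 1 <= (2 + eps) * x i 0].
have costA : \sum_(i in A) c i <= \sum_(i in A) c i * ((2 + eps) * x i 0).
  by apply: ler_sum => i; rewrite inE => iA; rewrite ler_peMr.
have costE : (2 + eps) * \sum_i c i * x i 0 =
    \sum_(i in A) c i * ((2 + eps) * x i 0) + \sum_(i in ~: A) c i * ((2 + eps) * x i 0).
  rewrite mulr_sumr (bigID (mem A)) /=; congr (_ + _).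
    by apply: eq_bigr => i _; ring.
  by apply: eq_big => i; [rewrite in_setC | move=> _; ring].
have cost0 (B : {set 'I_n}) : 0 <= \sum_(i in B) c i * ((2 + eps) * x i 0).
  apply: sumr_ge0 => i _; rewrite !mulr_ge0 ?addr_ge0 ?(ltW eps0) //.
  by case/andP: (x01 i).
have [DA|r0] := lerP D (\sum_(i in A) s i).
  by exists A; split=> //; rewrite costE; have := cost0 (~: A); lra.
rewrite -subr_gt0 in r0.
have := kc A r0; set r := D - _ in r0 * => kcA.
have [||||T [TA rT costT]] := @greedy_cover R n (~: A) (fun i => Num.min (s i) r) c
    (fun i => (2 + eps) * x i 0) r r0.
- by move=> i; rewrite lt_min s0 r0 ge_min lexx orbT.
- exact: c0.
- move=> i; rewrite !inE -ltNge => /ltW ->; rewrite andbT mulr_ge0 ?addr_ge0 ?(ltW eps0) //.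
  by case/andP: (x01 i).
- have -> : \sum_(i in ~: A) Num.min (s i) r * ((2 + eps) * x i 0) =
      (2 + eps) * \sum_(i | i \notin A) Num.min (s i) r * x i 0.
    by rewrite mulr_sumr; apply: eq_big => i; [rewrite in_setC | move=> _; ring].
  (* [(2 + eps) * (1 - eps / 3) = 2 + eps * (1 - eps) / 3], which is at least 2. *)
  apply: (@le_trans _ _ ((2 + eps) * ((1 - eps / 3) * r))).
    by rewrite mulrA ler_wpM2r ?(ltW r0) //; nra.
  by rewrite ler_wpM2l // addr_ge0 // ltW.
have disj : [disjoint A & T] by rewrite disjoint_sym disjoints_subset.
have sumU (F : 'I_n -> R) : \sum_(i in A :|: T) F i = \sum_(i in A) F i + \sum_(i in T) F i.
  by rewrite -bigU //=; apply: eq_bigl => i; rewrite in_setU.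
exists (A :|: T); rewrite !sumU; split.
  have : \sum_(i in T) Num.min (s i) r <= \sum_(i in T) s i.
    by apply: ler_sum => i _; rewrite ge_min lexx.
  by move: rT; rewrite /r; lra.
by rewrite costE lerD.
Qed.

Lemma dotv_chi (n : nat) (c : 'cV[RR]_n) (B : {set 'I_n}) :
  dotv c (chi _ B) = \sum_(i in B) c i 0.
Proof.
rewrite /dotv [RHS]big_mkcond; apply: eq_bigr => i _; rewrite mxE.
by case: (i \in B); rewrite ?mulr1 ?mulr0.
Qed.

Lemma knap_feasibleP (n : nat) (s : 'cV[RR]_n) (D : RR) (x : 'cV[RR]_n) :
  knap_feasible s D x <->
  exists2 B : {set 'I_n}, x = chi _ B & D <= \sum_(i in B) s i 0.
Proof.
split=> [[x01 Dx]|[B -> DB]]; last first.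
  by split=> [i|]; [rewrite mxE; case: (i \in B); [right | left] | rewrite dotv_chi].
have xE : x = chi _ [set i | x i 0 == 1].
  apply/matrixP => i j; rewrite ord1 mxE inE; case: (x01 i) => ->.
    by rewrite eq_sym oner_eq0.
  by rewrite eqxx.
by exists [set i | x i 0 == 1]; rewrite // -dotv_chi -xE.
Qed.

(** * The size bound and the theorem *)

(** The size is at most [16 n^2 T / eps], hence [2 ^ (49 l^2) / eps], where 43 of the 49 come from
    [T]. Since [l ln 2 <= 2 ln n], the exponent costs [4 * 49 = 196] over [ln 2]; the summand 1 pays
    for [1 / eps]. *)
Lemma quasipoly_bound (R : realType) (l n J : nat) (eps : R) :
  0 < eps -> eps < 1 -> (2 <= n)%N -> (0 < l)%N -> (n <= 2 ^ l)%N -> (2 ^ l <= n ^ 2)%N ->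
  ((n.*2).+2 <= threshold_size l)%N -> J.+1%:R <= 4 * n%:R / eps ->
  ((n.*2).+1 + (threshold_size l + n * J.+1 * (threshold_size l + (n.*2).+2)))%N%:R <=
  (1 / eps) `^ (1 + 196 / ln 2) * n%:R `^ ((1 + 196 / ln 2) * ln n%:R).
Proof.
move=> eps0 eps1 n2 l0 n_le l_le nT J_le.
set T := threshold_size l in nT *; set C := 1 + _.
have ln2 : 0 < ln 2 :> R by rewrite ln_gt0 // ltr1n.
have C1 : 1 <= C by rewrite lerDl divr_ge0 // ltW.
have n0 : 0 < n%:R :> R by rewrite ltr0n; lia.
have n2R : 2 <= n%:R :> R by rewrite (ler_nat _ 2).
have T0 : 0 <= T%:R :> R by [].
have size_le : ((n.*2).+1 + (T + n * J.+1 * (T + (n.*2).+2)))%N%:R <=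
    (2 ^ (49 * l ^ 2))%N%:R / eps.
  apply: (@le_trans _ _ (16 * n%:R ^+ 2 * T%:R / eps)).
    apply: (@le_trans _ _ (2 * T%:R + n%:R * (4 * n%:R / eps) * (2 * T%:R))).
      apply: (@le_trans _ _ (2 * T + n * J.+1 * (2 * T))%N%:R).
        rewrite ler_nat addnA leq_add ?leq_mul //; lia.
      by rewrite natrD !natrM lerD2l ler_wpM2r ?mulr_ge0 // ler_wpM2l.
    rewrite ler_pdivlMr // mulrDl.
    have -> : n%:R * (4 * n%:R / eps) * (2 * T%:R) * eps = 8 * (n%:R ^+ 2 * T%:R).
      by field; apply: lt0r_neq0.
    have : 2 * T%:R * eps <= 2 * (n%:R ^+ 2 * T%:R).
      rewrite -mulrA ler_wpM2l // mulrC ler_wpM2r // (le_trans (ltW eps1)) //.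
      by rewrite -natrX ler1n expn_gt0; lia.
    have : 0 <= n%:R ^+ 2 * T%:R :> R by rewrite mulr_ge0 // sqr_ge0.
    by lra.
  rewrite ler_pM2r ?invr_gt0 //.
  have -> : 16 * n%:R ^+ 2 * T%:R = (2 ^ 4 * n ^ 2 * T)%N%:R :> R by rewrite !natrM natrX.
  have -> : (2 ^ (49 * l ^ 2) = 2 ^ 4 * 2 ^ (2 * l) * 2 ^ (49 * l ^ 2 - 43 * l ^ 2 - 4 - 2 * l) * T)%N.
    have : (l <= l ^ 2)%N by rewrite leq_pmull.
    by rewrite /T /threshold_size -!expnD => ?; congr (2 ^ _)%N; lia.
  rewrite ler_nat leq_mul // -[leqLHS]muln1 leq_mul ?expn_gt0 // leq_mul //.
  by rewrite mulnC expnM leq_exp2r.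
apply: le_trans size_le _; rewrite mulrC ler_pM ?invr_ge0 ?(ltW eps0) //.
  rewrite div1r -[leLHS]powRr1 ?invr_ge0 ?(ltW eps0) //; apply: ler_powR => //.
  by rewrite invf_ge1 // ltW.
have ln_le : l%:R * ln 2 <= 2 * ln n%:R :> R.
  rewrite !mulr_natl -!lnXn // ler_ln ?posrE ?exprn_gt0 //.
  by rewrite -!natrX ler_nat.
rewrite /powR gt_eqF // natrX -[X in X ^+ _](@lnK R) ?posrE // -expRM_natl ler_expR.
rewrite natrM natrX.
have -> : 49 * l%:R ^+ 2 * ln 2 = 49 * (l%:R * ln 2) ^+ 2 / ln 2 :> R by field; apply: lt0r_neq0.
have -> : C * ln n%:R * ln n%:R = ln n%:R ^+ 2 + 49 * (2 * ln n%:R) ^+ 2 / ln 2 :> R.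
  by rewrite /C; field; apply: lt0r_neq0.
rewrite -[leLHS]add0r lerD ?sqr_ge0 // ler_pM2r ?invr_gt0 // ler_pM2l //.
have lnn : 0 <= ln n%:R :> R by rewrite ltW // ln_gt0 // ltr1n.
by rewrite lerXn2r ?nnegrE ?mulr_ge0 ?(ltW ln2).
Qed.

Theorem theorem1 :
  exists C : RR, 0 < C /\
  forall (eps : RR), 0 < eps -> eps < 1 ->
  forall (n : nat), (2 <= n)%N ->
  forall (s : 'cV[RR]_n) (D : RR),
    (forall i, 0 < s i 0) -> 0 < D ->
    (* the feasible set is nonempty *)
    D <= \sum_(i < n) s i 0 ->
  exists Q : ext_form n,
    [/\ (ef_size Q)%:R <= (1 / eps) `^ C * (n%:R) `^ (C * ln (n%:R)),
        is_relaxation s D Q &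
        gap_at_most s D Q (2 + eps)].
Proof.
have ln2 : 0 < ln 2 :> RR by rewrite ln_gt0 // ltr1n.
exists (1 + 196 / ln 2); split; first by rewrite addr_gt0 // divr_gt0.
move=> eps eps0 eps1 n n2 s D s0 _ _.
pose l := up_log 2 n; pose J := (Num.trunc (3 * n%:R / eps)).+1.
have l0 : (0 < l)%N by rewrite up_log_gt0.
have n_le : (n <= 2 ^ l)%N by apply: up_logP.
have l_le : (2 ^ l <= n ^ 2)%N.
  (* [2 ^ l.-1 < n] gives [2 ^ l < 2 * n <= n ^ 2]. *)
  have := up_log_gtn (isT : 1 < 2)%N n2; rewrite -/l -(prednK l0) expnS /=; nia.
have nl : (0 < n <= 2 ^ l)%N by rewrite n_le andbT; lia.
have Jd : n%:R < J%:R * (eps / 3).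
  rewrite mulrA ltr_pdivlMr // mulrC -ltr_pdivrMr //; exact: truncnS_gt.
have J_le : J.+1%:R <= 4 * n%:R / eps.
  have n_eps : 2 <= n%:R / eps.
    by rewrite ler_pdivlMr // (@le_trans _ _ 2) ?(ler_nat _ 2) // ler_piMr // ltW.
  have : (Num.trunc (3 * n%:R / eps))%:R <= 3 * n%:R / eps.
    by rewrite truncn_le divr_ge0 ?mulr_ge0 // ltW.
  by rewrite /J -!natr1 -!mulrA; lra.
have [S [liftS Sf SC]] := @knapsack_cover_relaxable _ n l J (fun i => s i 0) D _ l0 nl s0
  (divr_ge0 (ltW eps0) (ler0n _ 3)) Jd.
have [Q [Q_size Q_region]] := ext_form_of_lifted liftS.
exists Q; split.
- apply: le_trans (quasipoly_bound eps0 eps1 n2 l0 n_le l_le (box_le_threshold l0 nl) J_le).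
  by rewrite ler_nat.
- move=> x [N [lam [pts [lam0 lam1 feas ->]]]]; apply/Q_region.
  apply: lifted_convex liftS lam0 lam1 _ => j.
  by have /knap_feasibleP[B -> DB] := feas j; apply: Sf.
- move=> c c0 x /Q_region/SC[box_x kc_x].
  have [T [DT costT]] := @knapsack_cover_round _ n _ (fun i => c i 0) _ _ _ eps0 eps1 s0 c0 box_x kc_x.
  exists (chi _ T).
    exists 1%N, (fun=> 1), (fun=> chi _ T); split=> //.
    + by rewrite big_ord1.
    + by move=> _; apply/knap_feasibleP; exists T.
    + by rewrite big_ord1 scale1r.
  by rewrite dotv_chi.
Qed.
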